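(* For any integers $1\leq m\leq b$ and any integers $s'\geq s\geq 2m+1$ and $t'\geq t\geq \lceil s'/m\rceil$, there exists a graph $G$ such that $\gamma_{MB}(G,m:b)=t$ and $s_{MB}(G,m:b)=s$, but in the $(m:b)$ Maker-Breaker domination game on $G$ (Dominator, in the role of Maker, starting) Staller (in the role of Breaker) has a strategy such that all of the following hold: Dominator cannot claim a dominating set of size smaller than $s$; Dominator cannot win in fewer than $t$ rounds; and Dominator cannot claim a dominating set of size smaller than $s'$ if she wins in fewer than $t'$ moves.
   Context: The $(m:b)$ Maker-Breaker domination game on a graph $G$ is played by Dominator (Maker) and Staller (Breaker) on $V(G)$: they alternate moves, Dominator claiming up to $m$ unclaimed vertices per move and Staller up to $b$; Dominator wins if she claims all vertices of some dominating set of $G$. $\gamma_{MB}(G,m:b)$ is the smallest number of rounds within which Dominator can always win when she starts ($\infty$ if she cannot win), and $s_{MB}(G,m:b)$ is the smallest size of a dominating set that Dominator can always claim when she starts ($\infty$ if she cannot win). *)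

(* Defs.v *)
From HB Require Import structures.
From mathcomp Require Import all_boot.
From mathcomp Require Import boolp.

Set Implicit Arguments.
Unset Strict Implicit.
Unset Printing Implicit Defensive.

Record sgraph := SGraph {
  vertex :> finType;
  adj : rel vertex;
  adj_sym : symmetric adj;
  adj_irrefl : irreflexive adj }.

Definition dominating (G : sgraph) (A : {set G}) : bool :=
  [forall v : G, [exists u in A, (u == v) || adj u v]].

Definition ceil_divn (n d : nat) : nat := (n + d.-1) %/ d.

(* The least element of P in nat \cup {oo}, None standing for oo. *)
Definition least (P : nat -> Prop) : option nat :=
  match pselect (exists n, `[< P n >]) with
  | left exP => Some (ex_minn exP)
  | right _ => None
  end.

Lemma leastP (P : nat -> Prop) (n : nat) :
  least P = Some n <-> P n /\ forall k, P k -> n <= k.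
Proof.
rewrite /least; case: pselect => [exP|nexP]; last first.
  by split=> // -[Pn _]; case: nexP; exists n; apply/asboolP.
case: ex_minnP => k /asboolP Pk mink; split=> [[<-]|[Pn minn]].
  by split=> // j Pj; apply: mink; apply/asboolP.
congr Some; apply/eqP; rewrite eqn_leq minn // andbT.
by apply: mink; apply/asboolP.
Qed.

(* A play is given by D, S : nat -> {set G}, where D i and S i are the sets of
   vertices claimed by Dominator and by Staller in round i (rounds are numbered
   from 0, and Dominator moves first in each of them).  Claiming "up to"
   m (or b) vertices includes claiming none, so every play is extended to
   infinitely many rounds, with empty moves once the board is full.
   Nothing stops when Dominator wins: domination is preserved by later moves. *)
Section Game.
Variable G : sgraph.
Implicit Types (D S X : nat -> {set G}) (A : {set G}).

Definition claimed X (r : nat) : {set G} := \bigcup_(i < r) X i.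

Definition legal_dominator (m : nat) D S : Prop :=
  forall r, D r \subset ~: (claimed D r :|: claimed S r) /\ #|D r| <= m.

Definition legal_staller (b : nat) D S : Prop :=
  forall r, S r \subset ~: (claimed D r.+1 :|: claimed S r) /\ #|S r| <= b.

(* A strategy answers the list of all moves made so far by the opponent (the
   player's own moves can be recomputed from it). *)
Definition strategy := seq {set G} -> {set G}.

Definition dominator_follows (sigma : strategy) D S : Prop :=
  forall r, D r = sigma (mkseq S r).

Definition staller_follows (tau : strategy) D S : Prop :=
  forall r, S r = tau (mkseq D r.+1).

Definition dominator_ensures (m b : nat)
    (Q : (nat -> {set G}) -> (nat -> {set G}) -> Prop) : Prop :=
  exists sigma : strategy, forall D S,
    dominator_follows sigma D S -> legal_staller b D S ->
    legal_dominator m D S /\ Q D S.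

Definition staller_ensures (m b : nat)
    (Q : (nat -> {set G}) -> (nat -> {set G}) -> Prop) : Prop :=
  exists tau : strategy, forall D S,
    staller_follows tau D S -> legal_dominator m D S ->
    legal_staller b D S /\ Q D S.

Definition wins_in D (r : nat) : Prop := dominating (claimed D r).

Definition claims_in D (r : nat) A : Prop :=
  dominating A /\ A \subset claimed D r.

Definition gamma_MB (m b : nat) : option nat :=
  least (fun t => dominator_ensures m b
    (fun D _ => exists2 r, r <= t & wins_in D r)).

Definition s_MB (m b : nat) : option nat :=
  least (fun s => dominator_ensures m b
    (fun D _ => exists r A, claims_in D r A /\ #|A| <= s)).

End Game.

(* Main.v *)
Require Import Defs.
From mathcomp Require Import all_boot.
From mathcomp Require Import boolp zify.

(* Any monotone family W of subsets of a finite board X can be made the family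
   of traces on X of all small dominating sets of a graph: make X a clique and
   attach, for every B outside W, many copies of a vertex adjacent exactly to
   the complement of B.

   It then suffices to choose W well.  All sets of at least
   k = max(s', m(t-1)+1) elements are in W, which lets Dominator win in t rounds
   and no sooner.  All sets of at least s elements containing a "core" are in W
   too.  The board carries b+1 long cycles of blocks ("petals") through a common
   central block; a block consists of m vertices, every edge of a petal carries
   b more vertices, and a core consists of an edge vertex and of the two end
   blocks of that edge, 2m+1 vertices in total.

   Dominator can get a core: she takes the central block, then walks around a
   petal that Staller has not touched.  Once she is back at the center, Staller
   has had b moves per block walked, one b-tuple short of the number of edge
   vertices.  Staller can delay this.  He kills every block or edge of which
   Dominator claims only a part, and the central block if she takes another
   block first; otherwise he answers a whole block by claiming all vertices of
   an edge next to it, on the side where Dominator's next block is closer.  So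
   the distance between Dominator's blocks is at worst halved in every round,
   and cycles of length 2^t' + 1 are long enough for t' rounds. *)

Set Implicit Arguments.
Unset Strict Implicit.
Unset Printing Implicit Defensive.

(** * Positional strategies and their lifting to a graph *)

Section Strategies.
Variable G : sgraph.
Implicit Types (D S X : nat -> {set G}).

Lemma claimed0 X : claimed X 0 = set0.
Proof. by rewrite /claimed big_ord0. Qed.

Lemma claimedS X r : claimed X r.+1 = claimed X r :|: X r.
Proof. by rewrite /claimed big_ord_recr. Qed.

(** The position is recomputed by folding over the opponent's moves, so a rule that looks only at
    the position defines a strategy. *)
Lemma dominator_positional (f : {set G} -> {set G} -> {set G}) :
  exists sigma, forall D S, dominator_follows sigma D S ->
    forall r, D r = f (claimed D r) (claimed S r).
Proof.
pose step (st : {set G} * {set G}) s := (st.1 :|: f st.1 st.2, st.2 :|: s).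
pose state := foldl step (set0, set0).
exists (fun l => f (state l).1 (state l).2) => D S DS.
suff state_mkseq r : state (mkseq S r) = (claimed D r, claimed S r).
  by move=> r; rewrite DS state_mkseq.
elim: r => [|r IHr]; first by rewrite !claimed0.
rewrite mkseqS /state foldl_rcons -/(state _) IHr /step /= !claimedS.
by rewrite [D r]DS IHr.
Qed.

Lemma staller_positional (f : nat -> {set G} -> {set G} -> {set G}) :
  exists tau, forall D S, staller_follows tau D S ->
    forall r, S r = f r (claimed D r.+1) (claimed S r).
Proof.
pose reply (st : nat * {set G} * {set G}) d := f st.1.1 (st.1.2 :|: d) st.2.
pose step (st : nat * {set G} * {set G} * {set G}) d :=
  (st.1.1.1.+1, st.1.1.2 :|: d, st.1.2 :|: reply st.1 d, reply st.1 d).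
pose state := foldl step (0, set0, set0, set0).
exists (fun l => (state l).2) => D S SD.
have state_mkseq r : (state (mkseq D r)).1 = (r, claimed D r, claimed S r).
  elim: r => [|r IHr]; first by rewrite !claimed0.
  rewrite !claimedS [S r]SD mkseqS /state foldl_rcons -/(state _) /step.
  by rewrite IHr.
move=> r; rewrite [LHS]SD mkseqS /state foldl_rcons -/(state _) /step.
by rewrite state_mkseq claimedS.
Qed.

Lemma play_exists (sigma tau : strategy G) :
  exists D S, dominator_follows sigma D S /\ staller_follows tau D S.
Proof.
pose step (h : seq {set G} * seq {set G}) :=
  let ds := rcons h.1 (sigma h.2) in (ds, rcons h.2 (tau ds)).
pose hist r := iter r step ([::], [::]).
pose D r := sigma (hist r).2.
pose S r := tau (hist r.+1).1.
have histE r : hist r = (mkseq D r, mkseq S r).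
  elim: r => [//|r IHr].
  have -> : hist r.+1 = step (hist r) by [].
  rewrite !mkseqS -[mkseq D r]/(mkseq D r, mkseq S r).1.
  by rewrite -[mkseq S r]/(mkseq D r, mkseq S r).2 -IHr.
exists D, S; split=> r; first by rewrite {1}/D histE.
by rewrite {1}/S histE.
Qed.

End Strategies.

Section Lifting.
Variables (G : sgraph) (X : finType) (h : X -> G).
Hypothesis h_inj : injective h.
Variables m b : nat.
Implicit Types (A B M R : {set X}) (P : pred {set X}).

(** The game on the board [X] alone, with [n] rounds left and [A], [B] already claimed. Seen from
    [X], a move in [G] outside the image of [h] amounts to claiming less. *)
Fixpoint wins_within (P : pred {set X}) n A B : bool :=
  P A || if n is n'.+1 then
    [exists M : {set X}, [&& M \subset ~: (A :|: B), #|M| <= m &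
      [forall R : {set X},
        (R \subset ~: (A :|: M :|: B)) && (#|R| <= b) ==>
          wins_within P n' (A :|: M) (B :|: R)]]]
  else false.

Lemma wins_now P n A B : P A -> wins_within P n A B.
Proof. by move=> PA; case: n => [|n] /=; rewrite PA. Qed.

Lemma wins_step P n A B M :
    M \subset ~: (A :|: B) -> #|M| <= m ->
    (forall R, R \subset ~: (A :|: M :|: B) -> #|R| <= b ->
      wins_within P n (A :|: M) (B :|: R)) ->
  wins_within P n.+1 A B.
Proof.
move=> sM cM winM; apply/orP; right; apply/existsP; exists M.
rewrite sM cM /=; apply/forallP => R; apply/implyP => /andP[]; exact: winM.
Qed.

Lemma preim_claimedS (Z : nat -> {set G}) r :
  h @^-1: claimed Z r.+1 = h @^-1: claimed Z r :|: h @^-1: Z r.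
Proof. by rewrite claimedS preimsetU. Qed.

Lemma preim_imsetK A : h @^-1: (h @: A) = A.
Proof. by apply/setP => x; rewrite inE mem_imset. Qed.

Lemma card_preim_inj (U : {set G}) : #|h @^-1: U| <= #|U|.
Proof.
rewrite -(card_imset _ h_inj); apply: subset_leq_card.
by apply/subsetP => _ /imsetP[x + ->]; rewrite inE.
Qed.

Lemma imset_subC A (U : {set G}) :
  A \subset ~: (h @^-1: U) -> h @: A \subset ~: U.
Proof.
move=> /subsetP sA; apply/subsetP => _ /imsetP[x /sA + ->].
by rewrite !inE.
Qed.

Lemma preim_subC (U V : {set G}) :
  U \subset ~: V -> h @^-1: U \subset ~: (h @^-1: V).
Proof. by rewrite -preimsetC; apply: preimsetS. Qed.

Lemma dominator_ensures_wins P n : wins_within P n set0 set0 ->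
  dominator_ensures (G := G) m b
    (fun D _ => exists2 r, r <= n & P (h @^-1: (claimed D r))).
Proof.
(* A positional rule does not know how many rounds are left, so one move has to serve every horizon
   [k]. The move that wins for the least horizon does, and leaves a strictly smaller one. In all
   other positions the empty move is legal. *)
have move_exists (AB : {set X} * {set X}) : exists M,
    [/\ M \subset ~: (AB.1 :|: AB.2), #|M| <= m &
      forall k, wins_within P k AB.1 AB.2 -> P AB.1 \/
        exists2 j, j < k & forall R,
          R \subset ~: (AB.1 :|: M :|: AB.2) -> #|R| <= b ->
          wins_within P j (AB.1 :|: M) (AB.2 :|: R)].
  case: AB => A B /=.
  have [win|nowin] := pselect (exists k, wins_within P k A B); last first.
    exists set0; rewrite sub0set cards0; split=> // k win.
    by case: nowin; exists k.
  case: (ex_minnP win) => -[|k] + mink.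
    rewrite /= orbF => PA; exists set0; rewrite sub0set cards0; split=> //.
    by left.
  case/orP => [PA|/existsP[M /and3P[sM cM /forallP winM]]].
    by exists set0; rewrite sub0set cards0; split=> //; left.
  exists M; split=> // j /mink kj; right; exists k => // R sR cR.
  by have /implyP := winM R; rewrite sR cR; apply.
have [f fP] := choice move_exists.
pose pre (U : {set G}) := h @^-1: U.
have [sigma sigmaP] := dominator_positional
  (fun U V => h @: f (pre U, pre V)).
move=> win0; exists sigma => D S /sigmaP DE legalS; split=> [r|].
  rewrite DE card_imset //.
  by case: (fP (pre (claimed D r), pre (claimed S r))) => sM cM _; split=> //;
    apply: imset_subC; rewrite preimsetU.
suff reach k : forall r,
    wins_within P k (pre (claimed D r)) (pre (claimed S r)) ->
    exists2 q, q <= r + k & P (pre (claimed D q)).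
  by apply: (reach n 0); rewrite /pre !claimed0 preimset0.
elim/ltn_ind: k => k IHk r win.
have [sM cM] := fP (pre (claimed D r), pre (claimed S r)).
move=> /(_ k win)[PA|[j ltjk winR]]; first by exists r; rewrite ?leq_addr.
have [|q leq Pq] := IHk j ltjk r.+1; last by exists q => //; lia.
have preD : pre (D r) = f (pre (claimed D r), pre (claimed S r)).
  by rewrite DE /pre preim_imsetK.
have [sS cS] := legalS r.
rewrite /pre !preim_claimedS -/pre -/(pre (D r)) preD; apply: winR.
  by rewrite -preD /= -preim_claimedS -preimsetU; apply: preim_subC.
exact: leq_trans (card_preim_inj _) cS.
Qed.

(** Legality of Staller's moves is obtained without assuming Dominator's. This breaks the circle
    when the strategy meets one of Dominator's that is legal only against legal replies. *)
Lemma staller_ensures_invariant (Inv : nat -> {set X} -> {set X} -> Prop) K :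
    Inv 0 set0 set0 ->
    (forall r A B M, r < K -> Inv r A B ->
      M \subset ~: (A :|: B) -> #|M| <= m ->
      exists R, [/\ R \subset ~: (A :|: M :|: B), #|R| <= b &
        Inv r.+1 (A :|: M) (B :|: R)]) ->
  exists tau, forall D S : nat -> {set G}, staller_follows tau D S ->
    legal_staller b D S /\
    (legal_dominator m D S -> forall r, r <= K ->
      Inv r (h @^-1: (claimed D r)) (h @^-1: claimed S r)).
Proof.
move=> Inv0 InvS.
have move_exists (rAB : nat * {set X} * {set X}) : exists R,
    [/\ R \subset ~: (rAB.1.2 :|: rAB.2), #|R| <= b &
      (exists R', [/\ R' \subset ~: (rAB.1.2 :|: rAB.2), #|R'| <= b &
        Inv rAB.1.1.+1 rAB.1.2 (rAB.2 :|: R')]) ->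
      Inv rAB.1.1.+1 rAB.1.2 (rAB.2 :|: R)].
  case: rAB => -[r A] B /=.
  have [[R [sR cR IR]]|noR] := pselect (exists R',
    [/\ R' \subset ~: (A :|: B), #|R'| <= b & Inv r.+1 A (B :|: R')]).
    by exists R.
  by exists set0; rewrite sub0set cards0; split=> // /noR.
have [f fP] := choice move_exists.
pose pre (U : {set G}) := h @^-1: U.
have [tau tauP] := staller_positional
  (fun r U V => h @: f (r, pre U, pre V)).
exists tau => D S /tauP SE; split=> [r|legalD].
  rewrite SE card_imset //.
  by case: (fP (r, pre (claimed D r.+1), pre (claimed S r))) => sM cM _;
    split=> //; apply: imset_subC; rewrite preimsetU.
elim=> [|r IHr] ltrK; first by rewrite !claimed0 preimset0.
have {IHr} IHr := IHr (ltnW ltrK).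
have [sD cD] := legalD r.
have [||R [sR cR IR]] := InvS r _ _ (pre (D r)) ltrK IHr.
- by rewrite -preimsetU; apply: preim_subC.
- exact: leq_trans (card_preim_inj _) cD.
have [_ _] := fP (r, pre (claimed D r.+1), pre (claimed S r)).
have -> : f (r, pre (claimed D r.+1), pre (claimed S r)) = pre (S r).
  by rewrite SE /pre preim_imsetK.
rewrite /= /pre -preim_claimedS; apply.
by exists R; rewrite preim_claimedS.
Qed.

End Lifting.

(** * Graphs with a prescribed family of winning sets *)

Section FamilyGraph.
Variables (X : finType) (W : pred {set X}) (C : nat).

(** Every set [B] gets copies, which avoids a subtype; those with [W B] are adjacent to the whole
    clique and are dominated by any of its vertices. *)
Definition family_adj : rel (X + {set X} * 'I_C) := fun v w =>
  match v, w with
  | inl x, inl y => x != y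
  | inl x, inr (B, _) | inr (B, _), inl x => W B || (x \notin B)
  | inr _, inr _ => false
  end.

Lemma family_adj_sym : symmetric family_adj.
Proof. by case=> [x|[B i]] [y|[B' j]] //=; rewrite eq_sym. Qed.

Lemma family_adj_irrefl : irreflexive family_adj.
Proof. by case=> [x|[B i]] //=; rewrite eqxx. Qed.

Definition family_graph := SGraph family_adj_sym family_adj_irrefl.

Definition board_vertex (x : X) : family_graph := inl x.

Lemma board_vertex_inj : injective board_vertex.
Proof. by move=> x y []. Qed.

(** By monotonicity a trace in [W] lies in no [B] outside [W], so it meets the complement of [B].
    All other vertices only need the trace to be nonempty, hence [~~ W set0]. *)
Lemma dominating_family (A : {set family_graph}) :
    (forall B B' : {set X}, B \subset B' -> W B -> W B') -> ~~ W set0 ->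
  W (board_vertex @^-1: A) -> dominating A.
Proof.
move=> Wmono W0 WA; apply/forallP => -[y|[B i]].
  have /set0Pn[x] : board_vertex @^-1: A != set0.
    by apply: contraNneq W0 => <-.
  rewrite inE => xA; apply/existsP; exists (board_vertex x); rewrite xA /=.
  by case: eqVneq => //= nxy; apply: contra_neq nxy => ->.
have [WB|nWB] := boolP (W B).
  have /set0Pn[x] : board_vertex @^-1: A != set0.
    by apply: contraNneq W0 => <-.
  rewrite inE => xA; apply/existsP; exists (board_vertex x).
  by rewrite xA /= WB.
have /subsetPn[x] : ~~ (board_vertex @^-1: A \subset B).
  by apply: contra nWB => sAB; apply: Wmono WA.
rewrite inE => xA xB; apply/existsP; exists (board_vertex x).
by rewrite xA /= xB orbT.
Qed.

(** If the trace [B] of [A] were outside [W], no vertex of [A] would be adjacent to a copy of [B],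
    so [A] would have to contain all [C] copies. *)
Lemma family_dominating (A : {set family_graph}) :
  #|A| < C -> dominating A -> W (board_vertex @^-1: A).
Proof.
move=> cA domA; set B := _ @^-1: A; apply: contraTT cA => nWB; rewrite -leqNgt.
suff copyA i : (inr (B, i) : family_graph) \in A.
  have <- : #|[set (inr (B, i) : family_graph) | i in 'I_C]| = C.
    by rewrite card_imset ?card_ord // => i j [].
  by apply: subset_leq_card; apply/subsetP => _ /imsetP[i _ ->].
have /existsP[u /andP[uA /orP[/eqP <- //|]]] :=
  forallP domA (inr (B, i) : family_graph).
by case: u uA => [x|[? ?]] //= xA; rewrite (negbTE nWB) !inE /= xA.
Qed.

End FamilyGraph.

(** * The board, and how Dominator gets a core *)

Lemma cardsU_le (T : finType) (A B : {set T}) : #|A :|: B| <= #|A| + #|B|.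
Proof. by rewrite leq_card_setU. Qed.

Lemma subset_of_card (T : finType) (A : {set T}) n :
  n <= #|A| -> exists2 B : {set T}, B \subset A & #|B| = n.
Proof.
move=> nA; exists [set x in take n (enum A)].
  by apply/subsetP => x; rewrite inE => /mem_take; rewrite mem_enum.
rewrite cardsE (card_uniqP _) ?take_uniq ?enum_uniq //.
by rewrite size_takel // -cardE.
Qed.

(** Dominator claims any [m] free vertices in each round; the bound on [#|X|] keeps that many
    available to the end. *)
Lemma wins_by_filling (X : finType) (m b : nat) (P : pred {set X}) n q
    (A B : {set X}) :
    (forall A' : {set X}, A \subset A' -> q <= #|A'| -> P A') ->
    q <= #|A| + n * m -> #|A| + #|B| + n * (m + b) <= #|X| ->
  wins_within m b P n A B.
Proof.
elim: n A B => [|n IHn] A B PA cA room.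
  by rewrite wins_now // PA //; lia.
rewrite !mulSn in cA room.
have cAB := cardsC (A :|: B); have cAB' := cardsU_le A B.
have [|M sM cM] := @subset_of_card _ (~: (A :|: B)) m; first lia.
have cAM : #|A :|: M| = #|A| + m.
  rewrite -cM -cardsUI [A :&: M]disjoint_setI0 ?cards0 ?addn0 //.
  rewrite disjoint_sym disjoints_subset; apply: subset_trans sM _.
  by rewrite setCS subsetUl.
apply: (wins_step sM); first by rewrite cM.
move=> R _ cR; apply: IHn; last 1 first.
- by have := cardsU_le B R; lia.
- by move=> A' sA'; apply: PA; apply: subset_trans sA'; apply: subsetUl.
- lia.
Qed.

Section Board.
Variables m b L pads : nat.

(** [None] is the central block, shared by the [b.+1] petals; each petal has [L] further blocks,
    hence [L.+1] edges. *)
Definition block_id : finType := option ('I_b.+1 * 'I_L)%type.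

Definition board : finType :=
  ('I_pads + block_id * 'I_m + 'I_b.+1 * 'I_L.+1 * 'I_b)%type.

Implicit Types (A B M R : {set board}) (v : block_id) (p : 'I_b.+1).

Definition block_vertex v i : board := inl (inr (v, i)).

Definition edge_vertex p j i : board := inr (p, j, i).

Definition block v : {set board} := [set block_vertex v i | i : 'I_m].

Definition edge p j : {set board} := [set edge_vertex p j i | i : 'I_b].

(** The cycle is unrolled into positions [0] to [L.+1], both ends being the center since [insub]
    fails at [L]. Edge [j] joins positions [j] and [j.+1]. *)
Definition pos p (j : nat) : block_id :=
  if j is j'.+1 then omap (pair p) (insub j') else None.

Definition has_core A : bool :=
  [exists p, exists j : 'I_L.+1, [&& block (pos p j) \subset A,
    block (pos p j.+1) \subset A & ~~ [disjoint edge p j & A]]].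

Lemma block_vertex_in v i : block_vertex v i \in block v.
Proof. exact: imset_f. Qed.

Lemma edge_vertex_in p j i : edge_vertex p j i \in edge p j.
Proof. exact: imset_f. Qed.

Lemma card_block v : #|block v| = m.
Proof. by rewrite card_imset ?card_ord // => i j []. Qed.

Lemma card_edge p j : #|edge p j| = b.
Proof. by rewrite card_imset ?card_ord // => i k []. Qed.

Lemma pos_last p : pos p L.+1 = None.
Proof. by rewrite /= insubF // ltnn. Qed.

Lemma pos_inner p (j : 'I_L) : pos p j.+1 = Some (p, j).
Proof. by rewrite /= valK. Qed.

Lemma posP p j : j <= L.+1 ->
  [\/ j = 0 /\ pos p j = None, j = L.+1 /\ pos p j = None |
      exists2 i : 'I_L, j = i.+1 & pos p j = Some (p, i)].
Proof.
case: j => [|j] lejL; first by constructor 1.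
have [ltjL|leLj] := ltnP j L.
  by constructor 3; exists (Ordinal ltjL); rewrite // -(pos_inner p).
have -> : j = L by lia.
by constructor 2; rewrite pos_last.
Qed.

Lemma has_coreS A A' : A \subset A' -> has_core A -> has_core A'.
Proof.
move=> sA /existsP[p /existsP[j /and3P[s1 s2 nd]]].
apply/existsP; exists p; apply/existsP; exists j.
rewrite !(subset_trans _ sA) //=.
by apply: contra nd; apply: disjointWr.
Qed.

Lemma core_subset A s : 2 * m + 1 <= s -> s <= #|A| -> has_core A ->
  exists A' : {set board}, [/\ A' \subset A, has_core A' & #|A'| = s].
Proof.
move=> les lesA /existsP[p /existsP[j /and3P[s1 s2]]].
move=> /pred0Pn[z /andP[/= zE zA]].
pose K := block (pos p j) :|: block (pos p j.+1) :|: [set z].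
have sKA : K \subset A by rewrite !subUset s1 s2 sub1set.
have cK : #|K| <= s.
  apply: leq_trans les; rewrite /K.
  have c1 := cardsU_le (block (pos p j) :|: block (pos p j.+1)) [set z].
  have c2 := cardsU_le (block (pos p j)) (block (pos p j.+1)).
  by move: c1 c2; rewrite !card_block cards1; lia.
have [|E sE cE] := @subset_of_card _ (A :\: K) (s - #|K|).
  by rewrite cardsD (setIidPr sKA); lia.
exists (K :|: E); split.
- by rewrite subUset sKA (subset_trans sE) ?subsetDl.
- apply/existsP; exists p; apply/existsP; exists j; rewrite /K.
  rewrite -!setUA !subsetUl /= setUCA subsetUl /=.
  by apply/pred0Pn; exists z; rewrite /= zE !inE eqxx !orbT.
- rewrite -(subnKC cK) -cE -cardsUI [K :&: E]disjoint_setI0 ?cards0 ?addn0 //.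
  rewrite disjoint_sym disjoints_subset; apply: subset_trans sE _.
  by apply/subsetP => x; rewrite !inE => /andP[].
Qed.

Definition petal_of (x : board) : option 'I_b.+1 :=
  match x with
  | inl (inr (Some (p, _), _)) | inr (p, _, _) => Some p
  | _ => None
  end.

Definition petal p : {set board} := [set x | petal_of x == Some p].

(** Pigeonhole: a vertex lies in at most one of the [b.+1] petals. *)
Lemma untouched_petal B : #|B| <= b -> exists p, [disjoint B & petal p].
Proof.
move=> cB; apply: contrapT => noP.
suff : #|[set Some p | p : 'I_b.+1]| <= #|petal_of @: B|.
  have -> : #|[set Some p | p : 'I_b.+1]| = b.+1.
    by rewrite card_imset ?card_ord // => p p' [].
  by move=> ltb; have := leq_trans ltb (leq_imset_card _ _); rewrite ltnNge cB.
apply: subset_leq_card; apply/subsetP => _ /imsetP[p _ ->].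
have /pred0Pn[x /andP[/= xB]] : ~~ [disjoint B & petal p].
  by apply/negP => dB; apply: noP; exists p.
by rewrite inE => /eqP <-; apply: imset_f.
Qed.

Hypotheses (m_gt0 : 0 < m) (b_gt0 : 0 < b).

Definition edges_before p i : {set board} :=
  [set edge_vertex p (inord k.1) k.2 | k : 'I_i * 'I_b].

Lemma card_edges_before p i : i <= L.+1 -> #|edges_before p i| = i * b.
Proof.
move=> leiL; rewrite card_imset ?card_prod ?card_ord //.
move=> [k c] [k' c'] [/(congr1 val) /=].
rewrite !inordK => [/val_inj -> -> //||];
  by have := ltn_ord k; have := ltn_ord k'; lia.
Qed.

Lemma edges_before_petal p i : edges_before p i \subset petal p.
Proof. by apply/subsetP => _ /imsetP[k _ ->]; rewrite inE. Qed.

(** One move completes the core; filling then adds [m >= 1] vertices per round, so [q] of the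
    remaining rounds suffice to reach size [q]. *)
Lemma wins_completing_core (P : pred {set board}) q n p (j : 'I_L.+1) c A B :
    (forall A', has_core A' -> q <= #|A'| -> P A') ->
    block (pos p j) \subset A -> block (pos p j.+1) \subset A ->
    edge_vertex p j c \notin A -> edge_vertex p j c \notin B ->
    #|A| + #|B| + (n + q).+1 * (m + b) <= #|{: board}| ->
  wins_within m b P (n + q).+1 A B.
Proof.
move=> Pcore own1 own2 freeA freeB room.
apply: (@wins_step _ _ _ _ _ _ _ [set edge_vertex p j c]).
- by rewrite sub1set !inE negb_or freeA.
- by rewrite cards1.
move=> R _ cR; apply: (@wins_by_filling _ _ _ _ _ q); last 1 first.
- have := cardsU_le B R; have := cardsU_le A [set edge_vertex p j c].
  by rewrite cards1; nia.
- move=> A' sA'; apply: Pcore; apply: has_coreS sA' _.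
  apply/existsP; exists p; apply/existsP; exists j.
  rewrite !subsetU ?own1 ?own2 //=.
  apply/pred0Pn; exists (edge_vertex p j c).
  by rewrite /= edge_vertex_in !inE eqxx orbT.
- by nia.
Qed.

(* The petal's edges are walked in order.  If every walked edge is fully
   claimed by the opponent, this already accounts for all of his moves in the
   petal, so that the next block is free. *)
Lemma wins_walking (P : pred {set board}) q p n i A B :
    (forall A', has_core A' -> q <= #|A'| -> P A') ->
    i + n = L ->
    (forall k, k <= i -> block (pos p k) \subset A) ->
    (forall x, x \in A -> x \in petal p ->
      exists2 k, k <= i & x \in block (pos p k)) ->
    #|B :&: petal p| <= i * b ->
    #|A| + #|B| + (n + q).+1 * (m + b) <= #|{: board}| ->
  wins_within m b P (n + q).+1 A B.
Proof.
move=> Pcore; elim/ltn_ind: n i A B => n IHn i A B in_L ownA petA cB room.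
(* Either an edge between two owned blocks has a vertex left to complete a core, or Staller has
   filled every such edge. *)
have [[j [c [own1 own2 freeB]]]|stuck] := pselect (exists (j : 'I_L.+1) c,
  [/\ block (pos p j) \subset A, block (pos p j.+1) \subset A &
      edge_vertex p j c \notin B]).
  apply: (wins_completing_core Pcore own1 own2 _ freeB room).
  apply/negP => zA; have [|k _ /imsetP[] //] := petA _ zA.
  by rewrite inE.
have sB k c : k < L.+1 -> block (pos p k) \subset A ->
    block (pos p k.+1) \subset A -> edge_vertex p (inord k) c \in B.
  move=> ltkL own1 own2; apply/negPn/negP => nB; apply: stuck.
  by exists (inord k), c; rewrite inordK.
case: n => [|n] in IHn in_L room *.
  (* Back at the center, all [L.+1] edges would be full, although Staller has at most [L * b]
     vertices in the petal. *)
  suff : #|edges_before p L.+1| <= #|B :&: petal p|.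
    by rewrite card_edges_before //; nia.
  apply: subset_leq_card; rewrite subsetI edges_before_petal andbT.
  apply/subsetP => _ /imsetP[[k c] _ ->] /=; apply: sB => //.
    by apply: ownA; have := ltn_ord k; lia.
  have [->|/eqP nkL] := eqVneq (nat_of_ord k) L.
    by rewrite pos_last -[None]/(pos p 0); apply: ownA.
  by apply: ownA; have := ltn_ord k; lia.
have ltiL : i < L by lia.
have posi : pos p i.+1 = Some (p, Ordinal ltiL) by rewrite -pos_inner.
have Bpetal : edges_before p i = B :&: petal p.
  apply/eqP; rewrite eqEcard card_edges_before ?cB ?andbT; last lia.
  rewrite subsetI edges_before_petal andbT.
  apply/subsetP => _ /imsetP[[k c] _ ->] /=.
  have := ltn_ord k => ltki; apply: sB.
  - by lia.
  - by apply: ownA; lia.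
  - by apply: ownA; lia.
have freeM x : x \in block (pos p i.+1) -> (x \notin A) && (x \notin B).
  move=> xM; have xp : x \in petal p.
    by move: xM; rewrite posi => /imsetP[c _ ->]; rewrite inE.
  apply/andP; split.
    apply/negP => xA; have [k leki] := petA x xA xp; case/imsetP: xM => c _ ->.
    rewrite posi => /imsetP[c' _ [] /esym].
    have [|[_ ->]|[_ ->]|[k' kk' ->]] // := @posP p k; first lia.
    by case=> /(congr1 val) /=; lia.
  apply/negP => xB; have: x \in B :&: petal p by rewrite inE xB.
  rewrite -Bpetal => /imsetP[k _ xE]; move: xM; rewrite xE.
  by case/imsetP.
apply: (@wins_step _ _ _ _ _ _ _ (block (pos p i.+1))).
- by apply/subsetP => x /freeM; rewrite !inE negb_or.
- by rewrite card_block.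
move=> R _ cR; rewrite addSn; apply: (IHn n _ i.+1).
- exact: ltnSn.
- lia.
- move=> k; rewrite leq_eqVlt => /predU1P[->|ltki]; first exact: subsetUr.
  by rewrite subsetU // ownA.
- move=> x; rewrite inE => /orP[xA xp|xM _].
    by have [k leki xk] := petA x xA xp; exists k => //; lia.
  by exists i.+1.
- rewrite setIUl; have := cardsU_le (B :&: petal p) (R :&: petal p).
  by have := subset_leq_card (subsetIl R (petal p)); nia.
- have := cardsU_le B R; have := cardsU_le A (block (pos p i.+1)).
  by rewrite card_block; nia.
Qed.

(** The rounds are one for the center, at most [L] for the other blocks, one for an edge vertex and
    [q] for filling. *)
Lemma wins_core (P : pred {set board}) q :
    (forall A, has_core A -> q <= #|A| -> P A) ->
    (L + q).+2 * (m + b) <= #|{: board}| ->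
  wins_within m b P (L + q).+2 set0 set0.
Proof.
move=> Pcore room; apply: (@wins_step _ _ _ _ _ _ _ (block None)).
- by rewrite setU0 setC0 subsetT.
- by rewrite card_block.
move=> R _ cR; rewrite !set0U.
have [p dR] := untouched_petal cR.
apply: (@wins_walking _ _ p _ 0) => //.
- by case.
- by move=> x xu _; exists 0.
- by rewrite disjoint_setI0 ?cards0.
- by rewrite card_block; nia.
Qed.

End Board.

(** * How Staller delays a core *)

Section Holding.
Variables m b L pads K : nat.
Hypotheses (m_gt0 : 0 < m) (m_le_b : m <= b) (K_L : 2 ^ K <= L.+1).

Local Notation board := (board m b L pads).
Local Notation block_id := (block_id b L).
Implicit Types (A B M R : {set board}) (v w : block_id) (p : 'I_b.+1).
Local Notation block := (@block m b L pads).
Local Notation edge := (@edge m b L pads).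
Local Notation pos := (@pos b L).

Definition hit v B : bool := ~~ [disjoint block v & B].

Definition open_segment p i j B : Prop :=
  (forall k, i <= k <= j -> ~~ hit (pos p k) B) /\
  (forall k : 'I_L.+1, i <= k < j -> ~~ (edge p k \subset B)).

(** Staller's invariant after [r] rounds. [held_block] says that a partly claimed block is spoilt,
    so that blocks can only be won in one move. [held_edge], with disjointness, excludes cores.
    [held_center] says that the center is settled before any other block is owned. The bound in
    [held_segment] starts at [2 ^ K] and halves each round. *)
Record held (r : nat) A B : Prop := Held {
  held_disjoint : [disjoint A & B];
  held_block v : [|| block v \subset A, hit v B | ~~ hit v A];
  held_edge p (j : 'I_L.+1) c : edge_vertex m pads p j c \in A ->
    hit (pos p j) B || hit (pos p j.+1) B;
  held_center : (block None \subset A) || hit None B \/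
    forall v, ~~ (block v \subset A);
  held_segment p i j : i < j <= L.+1 ->
    block (pos p i) \subset A -> block (pos p j) \subset A ->
    open_segment p i j B -> 2 ^ (K - r) <= j - i }.

Lemma hitP v B :
  reflect (exists i, block_vertex pads v i \in B) (hit v B).
Proof.
rewrite /hit; apply: (iffP pred0Pn) => [[_ /andP[/imsetP[i _ ->] iB]]|[i iB]].
  by exists i.
by exists (block_vertex pads v i); rewrite /= block_vertex_in.
Qed.

Lemma hitS v B B' : B \subset B' -> hit v B -> hit v B'.
Proof. by move=> sB; apply: contra; apply: disjointWr. Qed.

Lemma hitU v B B' : hit v (B :|: B') = hit v B || hit v B'.
Proof.
apply/hitP/orP => [[i]|[] /hitP[i iB]].
- by rewrite inE => /orP[] iB; [left|right]; apply/hitP; exists i.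
- by exists i; rewrite inE iB.
- by exists i; rewrite inE iB orbT.
Qed.

Lemma hit_block v w : hit v (block w) = (v == w).
Proof.
apply/hitP/eqP => [[i /imsetP[j _ []]] //|->].
by exists (Ordinal m_gt0); apply: block_vertex_in.
Qed.

Lemma hit_disjoint v A B :
  [disjoint A & B] -> block v \subset A -> ~~ hit v B.
Proof. by move=> dAB sA; rewrite negbK (disjointWl sA). Qed.

Lemma open_segmentS p i j B B' :
  B \subset B' -> open_segment p i j B' -> open_segment p i j B.
Proof.
move=> sB [nhit ncut]; split=> k kij.
  by apply: contra (nhit k kij); apply: hitS.
by apply: contra (ncut k kij) => sE; apply: subset_trans sB.
Qed.

Lemma open_segment_cat p i k j B :
  open_segment p i k B -> open_segment p k j B -> open_segment p i j B.
Proof.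
move=> [nhit ncut] [nhit' ncut']; split=> l lij.
  by have [lek|ltk] := leqP l k; [apply: nhit | apply: nhit']; lia.
by have [ltk|lek] := ltnP l k; [apply: ncut | apply: ncut']; lia.
Qed.

Lemma held0 : held 0 set0 set0.
Proof.
have nowned v : ~~ (block v \subset set0).
  by rewrite subset0 -card_gt0 card_block.
have disj0 (U : {set board}) : [disjoint U & set0] by rewrite -setI_eq0 setI0.
split=> [|v|p j c||p i j _ own]; first exact: disj0.
- by rewrite negbK disj0 !orbT.
- by rewrite inE.
- by right.
- by have := nowned (pos p i); rewrite own.
Qed.

Lemma held_no_core r A B : held r A B -> ~~ has_core A.
Proof.
move=> hAB; apply/existsP => -[p /existsP[j /and3P[own1 own2]]].
move=> /pred0Pn[_ /andP[/imsetP[c _ ->] /(held_edge hAB)]].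
by rewrite !(negbTE (hit_disjoint (held_disjoint hAB) _)).
Qed.

Lemma exp_half r : r < K -> 2 ^ (K - r) = (2 ^ (K - r.+1)).*2.
Proof. by move=> ltrK; rewrite -mul2n -expnS; congr (2 ^ _); lia. Qed.

(** * Replies to a move that completes no block *)

Section Reply.
Variables (r : nat) (A B M : {set board}).
Hypotheses (r_lt : r < K) (hAB : held r A B).
Hypotheses (freeM : M \subset ~: (A :|: B)) (cardM : #|M| <= m).

Lemma reply_disjoint R : R \subset ~: (A :|: M :|: B) ->
  [disjoint A :|: M & B :|: R].
Proof.
move=> freeR; rewrite disjoints_subset; apply/subsetP => x xAM.
rewrite in_setC in_setU negb_or; apply/andP; split.
  move: xAM; rewrite inE => /orP[xA|/(subsetP freeM)].
    by rewrite (disjointFr (held_disjoint hAB) xA).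
  by rewrite !inE negb_or => /andP[].
apply: contraTN xAM => /(subsetP freeR).
by rewrite !inE !negb_or => /andP[/andP[]] -> ->.
Qed.

Lemma kill_block v : ~~ (block v \subset A :|: M) ->
  exists R, [/\ R \subset ~: (A :|: M :|: B), #|R| <= 1 & hit v (B :|: R)].
Proof.
move=> /subsetPn[x xv xAM]; have [hB|nhB] := boolP (hit v B).
  by exists set0; rewrite sub0set cards0 setU0.
exists [set x]; rewrite cards1 sub1set in_setC in_setU negb_or xAM; split=> //.
  by apply: contra nhB => xB; apply/pred0Pn; exists x; rewrite /= xv.
by apply/pred0Pn; exists x; rewrite /= xv !inE eqxx orbT.
Qed.

(** What Staller needs for [held_block] and [held_edge] to survive Dominator's claim of [y]; pads
    are harmless. *)
Definition neutral (y : board) B' : bool :=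
  match y with
  | inl (inl _) => true
  | inl (inr (v, _)) => hit v B'
  | inr (p, j, _) => hit (pos p j) B' || hit (pos p j.+1) B'
  end.

Lemma neutralS y B' B'' : B' \subset B'' -> neutral y B' -> neutral y B''.
Proof.
move=> sB; case: y => [[//|[v i]]|[[p j] i]] /=; first exact: hitS.
by case/orP => /(hitS sB) ->; rewrite ?orbT.
Qed.

(** The claimed vertex was free, so the edge was not filled and two owned ends would be an open
    segment of length 1. As [r < K], the invariant demands length at least 2. *)
Lemma edge_not_owned p (j : 'I_L.+1) c : edge_vertex m pads p j c \in M ->
  ~~ [&& block (pos p j) \subset A & block (pos p j.+1) \subset A].
Proof.
move=> zM; apply/negP => /andP[own1 own2].
have := held_segment hAB _ own1 own2; rewrite ltnSn subSnn ltn_ord.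
rewrite (exp_half r_lt) => /(_ isT) le1; suff /le1 : open_segment p j j.+1 B.
  by have := expn_gt0 2 (K - r.+1); lia.
split=> k kj.
  have [->|->] : k = j \/ k = j.+1 by lia.
    exact: hit_disjoint (held_disjoint hAB) own1.
  exact: hit_disjoint (held_disjoint hAB) own2.
have -> : k = j by apply: val_inj => /=; lia.
apply/subsetPn; exists (edge_vertex m pads p j c); first exact: edge_vertex_in.
by have /subsetP/(_ _ zM) := freeM; rewrite !inE negb_or => /andP[].
Qed.

Hypothesis no_new : forall v, block v \subset A :|: M -> block v \subset A.

Lemma neutralize y : y \in M ->
  exists R, [/\ R \subset ~: (A :|: M :|: B), #|R| <= 1 & neutral y (B :|: R)].
Proof.
have kill v : ~~ (block v \subset A) -> exists R,
    [/\ R \subset ~: (A :|: M :|: B), #|R| <= 1 & hit v (B :|: R)].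
  by move=> nown; apply: kill_block; apply: contra nown; apply: no_new.
case: y => [[x|[v i]]|[[p j] c]] yM.
- by exists set0; rewrite sub0set cards0.
- apply: kill; apply: contraL yM => vA.
  have iA := subsetP vA _ (block_vertex_in pads v i).
  by apply/negP => /(subsetP freeM); rewrite !inE iA.
- have := edge_not_owned yM; rewrite negb_and => /orP[]/kill[R [sR cR hR]];
  by exists R; rewrite /= hR ?orbT.
Qed.

(** Each vertex of [M] is neutralized by at most one reply vertex, and [m <= b]. No block becomes
    owned, so no new pair has to obey [held_segment]. *)
Lemma reply_junk : exists R,
  [/\ R \subset ~: (A :|: M :|: B), #|R| <= b & held r.+1 (A :|: M) (B :|: R)].
Proof.
have /choice[f fP] : forall y, exists R, y \in M ->
    [/\ R \subset ~: (A :|: M :|: B), #|R| <= 1 & neutral y (B :|: R)].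
  move=> y; have [/neutralize[R PR]|] := boolP (y \in M); first by exists R.
  by exists set0.
pose R := \bigcup_(y in M) f y.
have freeR : R \subset ~: (A :|: M :|: B).
  by apply/bigcupsP => y /fP[].
have neutralR y : y \in M -> neutral y (B :|: R).
  move=> yM; have [_ _] := fP y yM; apply: neutralS; apply: setUS.
  exact: bigcup_sup.
exists R; split=> //.
  apply: leq_trans (leq_trans cardM m_le_b); rewrite -[#|M|]sum1_card.
  apply: leq_trans (_ : _ <= \sum_(y in M) #|f y|) _.
    apply: (big_rec2 (fun (U : {set board}) n => #|U| <= n)).
      by rewrite cards0.
    by move=> y n U _ cU; apply: leq_trans (cardsU_le _ _) _; rewrite leq_add2l.
  by apply: leq_sum => y /fP[].
split=> [|v|p j c||p i j ij own1 own2 open].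
- exact: reply_disjoint.
- have [/hitP[i iM]|nhM] := boolP (hit v M).
    by rewrite [hit v (B :|: R)](neutralR _ iM) orbT.
  rewrite !hitU (negbTE nhM) orbF.
  by case/or3P: (held_block hAB v) => [own|->|->]; rewrite ?orbT ?subsetU ?own.
- rewrite inE => /orP[/(held_edge hAB)/orP[hB|hB]|zM].
  + by rewrite !hitU hB.
  + by rewrite !hitU hB !orbT.
  + exact: (neutralR _ zM).
- case: (held_center hAB) => [/orP[own|hB]|nown].
  + by left; rewrite subsetU ?own.
  + by left; rewrite hitU hB orbT.
  + by right=> v; apply: contra (nown v); apply: no_new.
apply: leq_trans (held_segment hAB ij (no_new own1) (no_new own2) _).
  by rewrite (exp_half r_lt) -addnn leq_addr.
by apply: open_segmentS open; apply: subsetUl.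
Qed.

End Reply.

(** * Replies to a move that claims a whole block *)

Section ReplyToBlock.
Variables (r : nat) (A B : {set board}) (v : block_id).
Hypotheses (r_lt : r < K) (hAB : held r A B).
Hypothesis (freev : block v \subset ~: (A :|: B)).

Let cardv : #|block v| <= m. Proof. by rewrite card_block. Qed.

Lemma owned_block w :
  block w \subset A :|: block v -> block w \subset A \/ w = v.
Proof.
move=> sw; have [->|nwv] := eqVneq w v; [by right | left].
apply/subsetP => x xw; have := subsetP sw x xw; rewrite inE => /orP[//|xv].
suff : hit w (block v) by rewrite hit_block (negbTE nwv).
by apply/pred0Pn; exists x; rewrite /= xw.
Qed.

Lemma held_reply_block R : R \subset ~: (A :|: block v :|: B) ->
    (block None \subset A :|: block v) || hit None (B :|: R) ->
    (forall p i j, i < j <= L.+1 ->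
      block (pos p i) \subset A :|: block v ->
      block (pos p j) \subset A :|: block v ->
      open_segment p i j (B :|: R) -> 2 ^ (K - r.+1) <= j - i) ->
  held r.+1 (A :|: block v) (B :|: R).
Proof.
move=> freeR center segment.
split=> [|w|p j c||] //; first exact: (reply_disjoint hAB).
- have [->|nwv] := eqVneq w v; first by rewrite subsetUr.
  rewrite !hitU hit_block (negbTE nwv) orbF.
  by case/or3P: (held_block hAB w) => [own|->|->]; rewrite ?orbT ?subsetU ?own.
- rewrite inE => /orP[/(held_edge hAB)/orP[hB|hB]|/imsetP[] //].
    by rewrite !hitU hB.
  by rewrite !hitU hB !orbT.
- by left.
Qed.

(** A Dominator vertex on the edge would force one of its end blocks to be hit, so Staller can still
    fill the edge. *)
Lemma open_edge_free p i j B' (k : 'I_L.+1) :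
  open_segment p i j B -> i <= k < j ->
  edge p k :\: B' \subset ~: (A :|: block v).
Proof.
move=> [nhit _] kij; apply/subsetP => x; rewrite !inE => /andP[_ xE].
apply/norP; split; last first.
  by case/imsetP: xE => c _ ->; apply/negP => /imsetP[].
case/imsetP: xE => c _ ->; apply/negP => /(held_edge hAB).
by rewrite (negbTE (nhit k _)) ?(negbTE (nhit k.+1 _)) //; lia.
Qed.

(** Staller can pass: the center was undecided, so no block was owned, and now the only owned
    positions are [0] and [L.+1], at distance at least [2 ^ K]. *)
Lemma reply_center : v = None -> exists R,
  [/\ R \subset ~: (A :|: block v :|: B), #|R| <= b &
      held r.+1 (A :|: block v) (B :|: R)].
Proof.
move=> vN; exists set0; rewrite sub0set cards0; split=> //.
apply: held_reply_block; first exact: sub0set.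
  by rewrite vN subsetUr.
have nown w : ~~ (block w \subset A).
  case: (held_center hAB) => [|-> //].
  have hv : hit None (block v) by rewrite vN hit_block.
  have /subsetP fv := freev; case/hitP: hv => c; move=> cv.
  have := fv _ cv; rewrite !inE negb_or => /andP[ncA ncB] /orP[/subsetP sA|hB].
    by rewrite sA ?block_vertex_in in ncA.
  have [x] := pred0Pn hB; rewrite /= -vN => /andP[/fv].
  by rewrite !inE negb_or => /andP[_ /negbTE ->].
have ownN w : block w \subset A :|: block v -> w = None.
  by case/owned_block => [own|-> //]; have := nown w; rewrite own.
move=> p i j /andP[ltij lej] /ownN posi /ownN posj _.
have := @posP b L p i; have := @posP b L p j.
rewrite posi posj => /(_ lej)[[j0 _]|[jL _]|[]//]; first lia.
move=> []; [lia| move=> [i0 _] | lia | by case].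
by apply: leq_trans (leq_trans K_L _); [apply: leq_pexp2l; lia | lia].
Qed.

Lemma pos_inj p x p' i : i <= L.+1 -> pos p' i = Some (p, x) ->
  p' = p /\ i = x.+1.
Proof.
move=> leiL; have [[_ ->]|[_ ->]|[k -> ->]] // := @posP b L p' i leiL.
by case=> -> ->.
Qed.

(** With the center undecided, [v] is the only owned block, so no segment is at stake and one vertex
    of the center is enough. *)
Lemma reply_kill_center p x : v = Some (p, x) ->
    ~~ ((block None \subset A) || hit None B) -> exists R,
  [/\ R \subset ~: (A :|: block v :|: B), #|R| <= b &
      held r.+1 (A :|: block v) (B :|: R)].
Proof.
move=> vE ncenter; case: (held_center hAB) => [|nown].
  by rewrite (negbTE ncenter).
have [|R [sR cR hR]] := @kill_block A B (block v) None.
  apply/negP => /owned_block[own|]; last by rewrite vE.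
  by have := nown None; rewrite own.
exists R; split=> //; first by lia.
apply: held_reply_block => //; first by rewrite hR orbT.
have ownv w : block w \subset A :|: block v -> w = Some (p, x).
  by case/owned_block => [own|-> //]; have := nown w; rewrite own.
move=> p' i j ij /ownv/pos_inj[|_ iE]; first lia.
by move=> /ownv/pos_inj[|_ jE]; lia.
Qed.

(* Two short segments on both sides of the new block would form an open segment
   violating the invariant, so that cutting one side is enough. *)
Lemma reply_cut p (x : 'I_L) : v = Some (p, x) ->
    (block None \subset A) || hit None B -> exists R,
  [/\ R \subset ~: (A :|: block v :|: B), #|R| <= b &
      held r.+1 (A :|: block v) (B :|: R)].
Proof.
move=> vE center; pose h := 2 ^ (K - r.+1).
have center' R : (block None \subset A :|: block v) || hit None (B :|: R).
  by case/orP: center => [own|hB]; rewrite ?hitU ?hB ?orbT ?subsetU ?own.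
have posx : pos p x.+1 = v by rewrite pos_inner.
have ltxL := ltn_ord x.
have cut_free i j (k : 'I_L.+1) : open_segment p i j B -> i <= k < j ->
    edge p k :\: B \subset ~: (A :|: block v :|: B).
  move=> open kij; have /subsetP sE := open_edge_free B open kij.
  apply/subsetP => y yE; have := sE _ yE; rewrite !inE => /negbTE->.
  by move: yE; rewrite inE => /andP[].
have cut_card (k : 'I_L.+1) : #|edge p k :\: B| <= b.
  by apply: leq_trans (subset_leq_card (subsetDl _ _)) _; rewrite card_edge.
have cut_closed i j (k : 'I_L.+1) : i <= k < j ->
    ~ open_segment p i j (B :|: edge p k :\: B).
  move=> kij [_ /(_ k kij)/negP]; apply; apply/subsetP => y yE.
  by rewrite !inE yE andbT orbN.
pose short_left i := [/\ i < x.+1, block (pos p i) \subset A,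
  open_segment p i x.+1 B & x.+1 - i < h].
pose short_right j := [/\ x.+1 < j <= L.+1, block (pos p j) \subset A,
  open_segment p x.+1 j B & j - x.+1 < h].
have not_both i j : short_left i -> short_right j -> False.
  move=> [lti owni openi di] [ltj ownj openj dj].
  have := held_segment hAB _ owni ownj (open_segment_cat openi openj).
  by rewrite (exp_half r_lt) -/h => /(_ _); lia.
(* Only pairs involving the new block, at position [x.+1], can be too close: older pairs obey twice
   the bound [h]. *)
have segments R :
    (forall i, open_segment p i x.+1 (B :|: R) -> ~ short_left i) ->
    (forall j, open_segment p x.+1 j (B :|: R) -> ~ short_right j) ->
    forall p' i j, i < j <= L.+1 ->
      block (pos p' i) \subset A :|: block v ->
      block (pos p' j) \subset A :|: block v ->
      open_segment p' i j (B :|: R) -> 2 ^ (K - r.+1) <= j - i.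
  move=> noleft noright p' i j ij own1 own2 open; rewrite -/h.
  have openB : open_segment p' i j B.
    by apply: open_segmentS open; apply: subsetUl.
  rewrite leqNgt; apply/negP => short.
  case: (owned_block own1) => [own1A|posi]; last first.
    have [||pE iE] := @pos_inj p x p' i; [lia|by rewrite posi|subst p' i].
    case: (owned_block own2) => [own2A|posj].
      by apply: (noright j open); split.
    by have [||_ jE] := @pos_inj p x p j; [lia|rewrite posj|lia].
  case: (owned_block own2) => [own2A|posj].
    have := held_segment hAB ij own1A own2A openB.
    by rewrite (exp_half r_lt) -/h; lia.
  have [||pE jE] := @pos_inj p x p' j; [lia|by rewrite posj|subst p' j].
  by apply: (noleft i open); split=> //; lia.
have [[i left_i]|noleft] := pselect (exists i, short_left i).
  (* Edge [x] ends at the new block, so filling it closes every segment from the left;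
     symmetrically, edge [x.+1] serves for the right. *)
  pose k : 'I_L.+1 := inord x; have kE : k = x :> nat by rewrite inordK //; lia.
  have [lti _ openi _] := left_i.
  exists (edge p k :\: B); split=> //; first by apply: cut_free openi _; lia.
  apply: held_reply_block => //; first by apply: cut_free openi _; lia.
  apply: segments => [i' open [lti' _ _ _]|j _ right_j].
    by apply: cut_closed open; lia.
  exact: not_both left_i right_j.
have [[j right_j]|noright] := pselect (exists j, short_right j).
  pose k : 'I_L.+1 := inord x.+1.
  have kE : k = x.+1 :> nat by rewrite inordK //; lia.
  have [ltj _ openj _] := right_j.
  exists (edge p k :\: B); split=> //; first by apply: cut_free openj _; lia.
  apply: held_reply_block => //; first by apply: cut_free openj _; lia.
  apply: segments => [i' _ left_i'|j' open [ltj' _ _ _]].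
    exact: not_both left_i' right_j.
  by apply: cut_closed open; lia.
exists set0; rewrite sub0set cards0; split=> //.
apply: held_reply_block => //; first exact: sub0set.
apply: segments => [i _ left_i|j _ right_j]; first by apply: noleft; exists i.
by apply: noright; exists j.
Qed.

Lemma reply_block : exists R,
  [/\ R \subset ~: (A :|: block v :|: B), #|R| <= b &
      held r.+1 (A :|: block v) (B :|: R)].
Proof.
case vE: v => [[p x]|]; last by rewrite -vE; apply: reply_center.
rewrite -vE.
have [center|center] := boolP ((block None \subset A) || hit None B).
  exact: reply_cut vE center.
exact: reply_kill_center vE center.
Qed.

End ReplyToBlock.

(** By [held_block], a newly owned block had no Dominator vertex before, so it lies in [M]; having
    [m] vertices, it is all of [M]. Hence the two kinds of reply cover every move. *)
Lemma held_reply r A B M : r < K -> held r A B ->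
    M \subset ~: (A :|: B) -> #|M| <= m ->
  exists R, [/\ R \subset ~: (A :|: M :|: B), #|R| <= b &
    held r.+1 (A :|: M) (B :|: R)].
Proof.
move=> r_lt hAB freeM cardM.
have [[v /andP[vAM nvA]]|no_new] := pselect (exists v,
  (block v \subset A :|: M) && ~~ (block v \subset A)); last first.
  apply: reply_junk => // v vAM; apply/negPn/negP => nvA; apply: no_new.
  by exists v; rewrite vAM.
have nhB : ~~ hit v B.
  apply: hit_disjoint vAM; rewrite disjoints_subset subUset.
  rewrite -disjoints_subset (held_disjoint hAB).
  by apply: subset_trans freeM _; rewrite setCS subsetUr.
have nhA : ~~ hit v A.
  by have := held_block hAB v; rewrite (negbTE nvA) (negbTE nhB).
have vM : block v \subset M.
  apply/subsetP => y yv; have := subsetP vAM y yv; rewrite inE => /orP[yA|//].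
  by case/pred0Pn: nhA; exists y; rewrite /= yv.
have ME : M = block v.
  by apply/eqP; rewrite eq_sym eqEcard vM card_block.
by rewrite ME; apply: reply_block; rewrite // -ME.
Qed.

End Holding.

(** * The two ways of winning combined *)

Lemma dominator_ensuresW (G : sgraph) m b
    (Q Q' : (nat -> {set G}) -> (nat -> {set G}) -> Prop) :
  (forall D S, Q D S -> Q' D S) ->
  dominator_ensures m b Q -> dominator_ensures m b Q'.
Proof.
move=> QQ' [sigma sigmaP]; exists sigma => D S DS /(sigmaP D S DS)[legalD /QQ'].
by split.
Qed.

Lemma card_claimed (G : sgraph) m (D S : nat -> {set G}) r :
  legal_dominator m D S -> #|claimed D r| <= r * m.
Proof.
move=> legalD; elim: r => [|r IHr]; first by rewrite claimed0 cards0.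
rewrite claimedS mulSn addnC; apply: leq_trans (cardsU_le _ _) _.
by apply: leq_add => //; case: (legalD r).
Qed.

Lemma ceil_divn_le n d t : 0 < d -> ceil_divn n d <= t -> n <= t * d.
Proof.
rewrite /ceil_divn => d_gt0 let'; have := ltn_ceil (n + d.-1) d_gt0; nia.
Qed.

Section Construction.
Variables m b s s' t t' : nat.
Hypotheses (m_gt0 : 0 < m) (m_le_b : m <= b).
Hypotheses (s_ge : 2 * m + 1 <= s) (s_le : s <= s').
Hypotheses (t_ge : ceil_divn s' m <= t) (t_le : t <= t').

Let L := 2 ^ t'.
(** More than [t.-1] rounds can yield, and at least [s'], yet within reach of [t] rounds because
    [s' <= t * m]. *)
Let k := maxn s' (m * t.-1).+1.
(** The pads alone give room for the rounds of both of Dominator's strategies. *)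
Let X := board m b L ((L + s).+2 * (m + b) + t * (m + b)).

Definition winning_family (A : {set X}) : bool :=
  (k <= #|A|) || ((s <= #|A|) && has_core A).

(** The copies outnumber every set to which the converse [winning_dominating] is applied: those
    claimed in under [t] rounds and those of fewer than [s'] vertices. *)
Let G := family_graph winning_family (m * t + s').+1.
Let pre (A : {set G}) : {set X} := @board_vertex _ _ _ @^-1: A.

Lemma winning_familyS (A A' : {set X}) :
  A \subset A' -> winning_family A -> winning_family A'.
Proof.
move=> sA /orP[kA|/andP[sizeA coreA]]; apply/orP.
  by left; apply: leq_trans (subset_leq_card sA).
right; rewrite (leq_trans sizeA (subset_leq_card sA)).
exact: has_coreS coreA.
Qed.

Lemma winning_family_size (A : {set X}) : winning_family A -> s <= #|A|.
Proof.
case/orP => [|/andP[]//]; apply: leq_trans.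
by rewrite /k; lia.
Qed.

Lemma winning_family0 : ~~ winning_family set0.
Proof.
by apply/negP => /winning_family_size; rewrite cards0; lia.
Qed.

Lemma k_le : k <= t * m.
Proof.
have := ceil_divn_le m_gt0 t_ge; rewrite /k.
by case: (t) t_ge => [|t0] _ /=; nia.
Qed.

Lemma board_size : (L + s).+2 * (m + b) + t * (m + b) <= #|X|.
Proof. by rewrite /X !card_sum card_ord; lia. Qed.

Lemma dominating_winning (A : {set G}) : winning_family (pre A) -> dominating A.
Proof. exact: dominating_family winning_familyS winning_family0. Qed.

Lemma winning_dominating (A : {set G}) :
  #|A| <= m * t + s' -> dominating A -> winning_family (pre A).
Proof. by move=> cA; apply: family_dominating; rewrite ltnS. Qed.

Lemma card_pre (A : {set G}) : #|pre A| <= #|A|.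
Proof. exact: card_preim_inj (@board_vertex_inj _ _ _) _. Qed.

Lemma dominating_size (A : {set G}) : dominating A -> s <= #|A|.
Proof.
move=> domA; rewrite leqNgt; apply/negP => ltA.
have /winning_family_size : winning_family (pre A).
  by apply: winning_dominating domA; lia.
by have := card_pre A; lia.
Qed.

Lemma dominator_fast :
  dominator_ensures m b (fun (D _ : nat -> {set G}) =>
    exists2 r, r <= t & wins_in D r).
Proof.
apply: dominator_ensuresW; last first.
  apply: (@dominator_ensures_wins G X _ (@board_vertex_inj _ _ _) m b
    winning_family t).
  apply: (@wins_by_filling _ _ _ _ _ k).
  - by move=> A' _ kA'; apply/orP; left.
  - by rewrite cards0; apply: k_le.
  - by rewrite cards0; have := board_size; lia.
by move=> D S [r ler /dominating_winning domD]; exists r.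
Qed.

(** Dominator aims for a core and [s] vertices in all; a core within [s] of these vertices is then a
    dominating set of exactly that size. *)
Lemma dominator_small :
  dominator_ensures m b (fun (D _ : nat -> {set G}) =>
    exists r A, claims_in D r A /\ #|A| <= s).
Proof.
apply: dominator_ensuresW; last first.
  apply: (@dominator_ensures_wins G X _ (@board_vertex_inj _ _ _) m b
    (fun A => (s <= #|A|) && has_core A) (L + s).+2).
  have b_gt0 : 0 < b by lia.
  apply: (wins_core m_gt0 b_gt0).
    by move=> A -> ->.
  exact: leq_trans (leq_addr _ _) board_size.
move=> D S [r _ /andP[sizeA coreA]].
have [A [sA cA sizeA']] := core_subset s_ge sizeA coreA.
exists r, (@board_vertex _ _ _ @: A); split; last first.
  by rewrite card_imset ?sizeA' //; apply: board_vertex_inj.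
split.
  apply: dominating_winning; rewrite /pre preim_imsetK.
    by rewrite /winning_family sizeA' cA leqnn orbT.
  exact: board_vertex_inj.
by apply/subsetP => _ /imsetP[x /(subsetP sA) + ->]; rewrite inE.
Qed.

Lemma staller_slows : exists tau : strategy G, forall D S,
  staller_follows tau D S -> legal_staller b D S /\
  (legal_dominator m D S ->
    [/\ forall r A, claims_in D r A -> s <= #|A|,
        forall r, wins_in D r -> t <= r &
        forall r A, r < t' -> claims_in D r A -> s' <= #|A|]).
Proof.
have [tau tauP] := @staller_ensures_invariant
  G X _ (@board_vertex_inj _ _ _) m b _ t' (@held0 m b L _ t' m_gt0)
  (fun r A B M => @held_reply m b L _ t' m_gt0 m_le_b (leqnSn _) r A B M).
exists tau => D S DS; have [legalS legalD_held] := tauP D S DS; split=> //.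
move=> legalD; have held_r := legalD_held legalD.
(* Up to round [t'] there is no core, so only size [k] can make a claimed set winning. *)
have slow r (A : {set G}) : r <= t' -> A \subset claimed D r -> #|A| < k ->
    winning_family (pre A) -> False.
  move=> ler sA cA /orP[|/andP[_ coreA]].
    by have := card_pre A; lia.
  have /negP := held_no_core (held_r r ler); apply.
  by apply: has_coreS coreA; apply: preimsetS.
split=> [r A [domA _]|r domD|r A ltr [domA sA]]; first exact: dominating_size.
  rewrite leqNgt; apply/negP => ltr; have cD := card_claimed r legalD.
  apply: (slow r (claimed D r)) => //; first by lia.
    by rewrite /k; nia.
  by apply: winning_dominating domD; nia.
rewrite leqNgt; apply/negP => cA; apply: (slow r A) => //; first lia.
  by rewrite /k; lia.
by apply: winning_dominating domA; lia.
Qed.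

(** The source of both lower bounds: whatever Dominator can ensure must hold in a play that also
    obeys Staller's guarantees. *)
Lemma dominator_meets_staller
    (Q : (nat -> {set G}) -> (nat -> {set G}) -> Prop) :
  dominator_ensures m b Q -> exists D S, Q D S /\
    [/\ forall r A, claims_in D r A -> s <= #|A|,
        forall r, wins_in D r -> t <= r &
        forall r A, r < t' -> claims_in D r A -> s' <= #|A|].
Proof.
move=> [sigma sigmaP]; have [tau tauP] := staller_slows.
have [D [S [Dsigma Stau]]] := play_exists sigma tau.
have [legalS slow] := tauP D S Stau.
have [legalD QDS] := sigmaP D S Dsigma legalS.
by exists D, S; split=> //; apply: slow.
Qed.

Lemma construction_correct :
  [/\ gamma_MB G m b = Some t, s_MB G m b = Some s &
    staller_ensures m b (fun (D _ : nat -> {set G}) =>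
      [/\ forall r A, claims_in D r A -> s <= #|A|,
          forall r, wins_in D r -> t <= r &
          forall r A, r < t' -> claims_in D r A -> s' <= #|A|])].
Proof.
split.
- apply/leastP; split; first exact: dominator_fast.
  move=> n /dominator_meets_staller[D [S [[r ler winr] [_ slow _]]]].
  exact: leq_trans (slow r winr) ler.
- apply/leastP; split; first exact: dominator_small.
  move=> n /dominator_meets_staller[D [S [[r [A [clA cA]]] [small _ _]]]].
  exact: leq_trans (small r A clA) cA.
- have [tau tauP] := staller_slows; exists tau => D S Stau legalD.
  by have [legalS slow] := tauP D S Stau; split=> //; apply: slow.
Qed.

End Construction.

Theorem theorem1p6 (m b s s' t t' : nat)
    (hm : 1 <= m) (hmb : m <= b)
    (hs : 2 * m + 1 <= s) (hss' : s <= s')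
    (ht : ceil_divn s' m <= t) (htt' : t <= t') :
  exists G : sgraph,
    [/\ gamma_MB G m b = Some t,
        s_MB G m b = Some s &
        staller_ensures m b (fun (D _ : nat -> {set G}) =>
          [/\ forall r A, claims_in D r A -> s <= #|A|,
              forall r, wins_in D r -> t <= r &
              forall r A, r < t' -> claims_in D r A -> s' <= #|A|])].
Proof. by eexists; apply: (@construction_correct m b s s' t t'). Qed.
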